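(* Let $(X,R,I)$ be a unital regular relation partition with $X$ finite, and let $g\in\mathbb{C}^X$ be an equi-distributed function with parameter set $(v,k,\lambda)$. Then $$\Big(\sum_{x\in X}g(x)\Big)\overline{\Big(\sum_{x\in X}g(x)\Big)}-\sum_{x\in X}g(x)\overline{g(x)}=\lambda(v-1)$$ holds. Thus, if $g(x)$ is real, the unbiased variance of $g(x)$ is equal to $\lambda$.
   Context: A relation partition $(X,R,I)$ consists of sets $X,I$ and a surjection $R:X\times X\to I$. It is regular if for every $i\in I$ there is an integer $k_i$ such that for all $x\in X$, $\#\{x'\in X: R(x,x')=i\}=k_i=\#\{x'\in X: R(x',x)=i\}$. It is unital if there is $i_0\in I$ (necessarily unique, called the unit) with $R^{-1}(\{i_0\})=\{(x,x):x\in X\}$. For $i\in I$, write $R^{-1}(i)=R^{-1}(\{i\})$, and let $A_i$ be the adjacency matrix: $A_i(x,x')=1$ if $R(x,x')=i$, and $0$ otherwise. For $g\in\mathbb{C}^X$, $(A_ig)(x')=\sum_{x\in X}A_i(x,x')g(x)$, and $(g,g')=\sum_{x\in X}g(x)\overline{g'(x)}$. For $(X,R,I)$ unital and $v=\#X$, the $i$-th inner distribution of $g$ is $\lambda_i:=v\cdot (A_ig,g)/\#R^{-1}(i)$. The function $g$ is equi-distributed if $\lambda_i$ is independent of the choice of $i\neq i_0$; it is then called $(v,k,\lambda)$-equi-distributed, where $v=\#X$, $k=\sum_{x\in X}g(x)$ (the mass of $g$), and $\lambda=\lambda_i$ for $i\neq i_0$.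
   Formalization: The closing claim that for real g the unbiased variance equals λ is false (X={0,1}, g=(0,1): λ=0, variance 1/2); it is replaced by: for real g and v≥2 the unbiased variance equals k²/v − λ. *)

(* Defs.v *)
From HB Require Import structures.
From mathcomp Require Import all_boot all_order all_algebra.
From mathcomp Require Import complex reals.

Set Implicit Arguments.
Unset Strict Implicit.
Unset Printing Implicit Defensive.

Import Order.TTheory GRing.Theory Num.Theory.

Local Open Scope ring_scope.

Record relation_partition (X I : Type) := RelationPartition {
  rel_of :> X * X -> I;
  rel_of_surj : forall i : I, exists p : X * X, rel_of p = i }.

Section RelationPartition.
Variables (X : finType) (I : eqType) (P : relation_partition X I).

Definition regular : Prop :=
  forall i : I, exists k : nat, forall x : X,
    #|[set x' : X | P (x, x') == i]| = k /\
    #|[set x' : X | P (x', x) == i]| = k.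

Definition is_unit (i0 : I) : Prop :=
  forall x x' : X, P (x, x') = i0 <-> x = x'.

Definition fiber (i : I) : {set X * X} := [set p | P p == i].

Variable C : numClosedFieldType.
Implicit Types g : X -> C.

Definition adjacency (i : I) (x x' : X) : C := (P (x, x') == i)%:R.

(* The sum runs over the first argument of the adjacency matrix. *)
Definition adj_act (i : I) g : X -> C :=
  fun x' => \sum_(x : X) adjacency i x x' * g x.

Definition hermitian_form g g' : C := \sum_(x : X) g x * (g' x)^*.

Definition mass g : C := \sum_(x : X) g x.

Definition inner_distribution g (i : I) : C :=
  #|X|%:R * hermitian_form (adj_act i g) g / #|fiber i|%:R.

Definition equi_distributed (i0 : I) g : Prop :=
  forall i j : I, i != i0 -> j != i0 ->
    inner_distribution g i = inner_distribution g j.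

(* When #|X| = 1 the unit is the only index and lambda is unconstrained. *)
Definition equi_distributed_with (i0 : I) g (v : nat) (k lambda : C) : Prop :=
  [/\ equi_distributed i0 g, v = #|X|, k = mass g
    & forall i : I, i != i0 -> inner_distribution g i = lambda].

End RelationPartition.

Section Variance.
Variables (X : finType) (F : fieldType).

Definition mean (g : X -> F) : F := (\sum_(x : X) g x) / #|X|%:R.

(* Bessel-corrected variance; a junk value when #|X| <= 1. *)
Definition unbiased_variance (g : X -> F) : F :=
  (\sum_(x : X) (g x - mean g) ^+ 2) / (#|X|%:R - 1).

End Variance.

(* Main.v *)
Require Import Defs.
From HB Require Import structures.
From mathcomp Require Import all_boot all_order all_algebra.
From mathcomp Require Import complex reals.
From mathcomp Require Import ring.

(** Expanding the product of the mass of [g] with its conjugate gives a sum of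
    [g x * (g x')^*] over all pairs; subtracting the diagonal terms leaves the
    sum over the pairs [x != x'].  As the unit fibre is the diagonal, these
    pairs are the disjoint union of the fibres of the indices [i != i0].  On
    such a fibre the sum of [g x * (g x')^*] is the form [(A_i g, g)], which by
    equi-distribution is [lambda / #|X|] times the size of the fibre
    ([sum_fiber_equi_distributed]).  The off-diagonal sum is therefore
    [lambda / #|X|] times the number [#|X| * (#|X| - 1)] of off-diagonal pairs.

    The formula for the variance follows from this identity and from the usual
    expansion of the sum of squared deviations ([sum_sqr_dev]), since
    conjugation is trivial on real values. *)

Set Implicit Arguments.
Unset Strict Implicit.
Unset Printing Implicit Defensive.

Import Order.TTheory GRing.Theory Num.Theory.

Local Open Scope ring_scope.

Lemma eq_sum_fibers (V : nmodType) (T : finType) (J : eqType) (f : T -> J)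
    (D : {set T}) (F G : T -> V) :
    (forall x, x \in D -> \sum_(y in D | f y == f x) F y
                            = \sum_(y in D | f y == f x) G y) ->
  \sum_(x in D) F x = \sum_(x in D) G x.
Proof.
move=> eqFG.
have partD := preim_partitionP f D.
rewrite !(set_partition_big _ partD); apply: eq_bigr => B /imsetP[x Dx ->].
have := eqFG x Dx; congr (_ = _); apply: eq_bigl => y;
  by rewrite inE eq_sym.
Qed.

Lemma card_off_diagonal (X : finType) :
  #|[set p : X * X | p.1 != p.2]| = (#|X| * #|X| - #|X|)%N.
Proof.
have -> : [set p : X * X | p.1 != p.2] = ~: [set (x, x) | x : X].
  apply/setP=> -[x y]; rewrite !inE /=; congr (~~ _).
  by apply/eqP/imsetP => [-> | [z _ [-> ->]] //]; exists y.
by rewrite cardsCs setCK card_prod card_imset // => x y [].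
Qed.

Lemma sum_off_diagonal (R : pzRingType) (X : finType) (a b : X -> R) :
  \sum_(p in [set p : X * X | p.1 != p.2]) a p.1 * b p.2
    = (\sum_x a x) * (\sum_x b x) - \sum_x a x * b x.
Proof.
apply/eqP; rewrite eq_sym subr_eq; apply/eqP.
rewrite mulr_suml (eq_bigl (fun p : X * X => p.1 != p.2)); last first.
  by move=> p; rewrite inE.
rewrite -(pair_big_dep xpredT (fun x y => x != y) (fun x y => a x * b y)) /=.
rewrite -big_split /=; apply: eq_bigr => x _.
rewrite mulr_sumr (bigD1 x) //= addrC; congr (_ + _).
by apply: eq_bigl => y; rewrite eq_sym.
Qed.

Section EquiDistributed.
Variables (C : numClosedFieldType) (X : finType) (I : eqType).
Variable P : relation_partition X I.
Implicit Types (g : X -> C) (i : I).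

Lemma card_fiber_gt0 i : (0 < #|fiber P i|)%N.
Proof. by have [p Pp] := rel_of_surj P i; apply/card_gt0P; exists p; rewrite inE Pp. Qed.

(** An index lies in the image of the surjection [P], so [X] has a point. *)
Lemma card_gt0_of_index i : (0 < #|X|)%N.
Proof. by have [[x _] _] := rel_of_surj P i; apply/card_gt0P; exists x. Qed.

Lemma hermitian_form_adj_act i g :
  hermitian_form (adj_act P i g) g
    = \sum_(p in fiber P i) g p.1 * (g p.2)^*.
Proof.
rewrite /hermitian_form /adj_act /adjacency.
under eq_bigr do rewrite mulr_suml.
rewrite exchange_big pair_big [RHS]big_mkcond /=.
apply: eq_bigr => -[x y] _; rewrite inE /=.
by case: eqP; rewrite ?mul1r ?mul0r.
Qed.

Lemma sum_fiber_equi_distributed i0 g v k lambda i :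
    equi_distributed_with P i0 g v k lambda -> i != i0 ->
  \sum_(p in fiber P i) g p.1 * (g p.2)^*
    = \sum_(p in fiber P i) lambda / #|X|%:R.
Proof.
move=> [_ _ _ /(_ i) hl] /hl <-.
have X0 : #|X|%:R != 0 :> C by rewrite pnatr_eq0 -lt0n (card_gt0_of_index i).
have f0 : #|fiber P i|%:R != 0 :> C by rewrite pnatr_eq0 -lt0n card_fiber_gt0.
rewrite sumr_const -mulr_natr /inner_distribution hermitian_form_adj_act.
by field; rewrite X0 f0.
Qed.

Lemma sqr_mass_sub_sum_norm i0 g v k lambda :
    is_unit P i0 -> equi_distributed_with P i0 g v k lambda ->
  (\sum_x g x) * (\sum_x g x)^* - \sum_x g x * (g x)^*
    = lambda * (v%:R - 1).
Proof.
move=> hunit hg; have [_ -> _ _] := hg.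
have X_gt0 := card_gt0_of_index i0.
have X0 : #|X|%:R != 0 :> C by rewrite pnatr_eq0 -lt0n.
rewrite rmorph_sum -sum_off_diagonal.
rewrite (eq_sum_fibers (f := P) (G := fun=> lambda / #|X|%:R)); last first.
  move=> q; rewrite inE => q_off.
  have Pq : P q != i0.
    by apply: contra q_off => /eqP; rewrite [q]surjective_pairing => /hunit ->.
  have inD p : (p \in [set p : X * X | p.1 != p.2]) && (P p == P q)
               = (p \in fiber P (P q)).
    rewrite !inE andbC; case: eqP => //= Ppq.
    apply: contra Pq; rewrite -Ppq => /eqP; case: p {Ppq} => x y /= ->.
    by apply/eqP/hunit.
  by rewrite !(eq_bigl _ _ inD); apply: sum_fiber_equi_distributed hg Pq.
rewrite sumr_const card_off_diagonal -[_ *+ (_ - _)]mulr_natr natrB ?leq_pmull // natrM.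
by field.
Qed.

End EquiDistributed.

Lemma sum_sqr_dev (F : fieldType) (X : finType) (g : X -> F) :
    #|X|%:R != 0 :> F ->
  \sum_x (g x - mean g) ^+ 2
    = \sum_x g x ^+ 2 - (\sum_x g x) ^+ 2 / #|X|%:R.
Proof.
move=> X0.
have sqr_dev x : (g x - mean g) ^+ 2
                   = g x ^+ 2 - 2 * mean g * g x + mean g ^+ 2 by ring.
under eq_bigr do rewrite sqr_dev.
rewrite big_split sumrB /= -mulr_sumr sumr_const -[_ *+ #|_|]mulr_natr /mean.
by field.
Qed.

Theorem theorem4p4 (R : realType) (X : finType) (I : eqType)
    (P : relation_partition X I) (hreg : regular P)
    (i0 : I) (hunit : is_unit P i0)
    (g : X -> R[i]) (v : nat) (k lambda : R[i])
    (hg : equi_distributed_with P i0 g v k lambda) :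
  (\sum_(x : X) g x) * (\sum_(x : X) g x)^* - \sum_(x : X) g x * (g x)^*
    = lambda * (v%:R - 1)
  /\ ((forall x : X, g x \is Num.real) -> (1 < v)%N ->
      unbiased_variance g = k ^+ 2 / v%:R - lambda).
Proof.
have eq_mass := sqr_mass_sub_sum_norm hunit hg.
split=> // g_real v_gt1; have [_ vE -> _] := hg.
have v0 : v%:R != 0 :> R[i] by rewrite pnatr_eq0 -lt0n ltnW.
have v1 : v%:R - 1 != 0 :> R[i] by rewrite subr_eq0 pnatr_eq1 gtn_eqF.
have g_conj x : (g x)^* = g x by apply/CrealP.
have mass_conj : (mass g)^* = mass g.
  by rewrite rmorph_sum; apply: eq_bigr => x _; apply: g_conj.
have sum_norm : \sum_x g x * (g x)^* = \sum_x g x ^+ 2.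
  by apply: eq_bigr => x _; rewrite g_conj expr2.
have sum_sqr : \sum_x g x ^+ 2 = mass g ^+ 2 - lambda * (v%:R - 1).
  by rewrite -eq_mass sum_norm -/(mass g) mass_conj -expr2 subKr.
rewrite /unbiased_variance sum_sqr_dev -vE // sum_sqr -/(mass g).
by field; rewrite v0 v1.
Qed.
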